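(* Let $k$ be a field and let $R=k[x_1,\dots,x_n]/I$, where $I$ is minimally generated over $k[x_1,\dots,x_n]$ by $t>0$ homogeneous polynomials of degree two. Then $$\binom{n+1}2-t\le\binom{\operatorname{cs}(R)+1}2.$$ In particular, if $t\le\dfrac{(s+1)(2n-s)}2$ for some integer $0\le s\le n-1$, then $\operatorname{cs}(R)\ge n-s-1$. Moreover, if $t\le n-1$, then $\operatorname{cs}(R)=n=\mu(\bar{\mathfrak m})$, where $\bar{\mathfrak m}$ is the image of $(x_1,\dots,x_n)$ in $R$.
   Context: $R$ is standard graded with homogeneous maximal ideal $\bar{\mathfrak m}$. For a homogeneous ideal $J$ of $R$, $\mu(J)=\dim_k(J/\bar{\mathfrak m}J)$ is the minimal number of generators, and $\operatorname{cs}(R)=\min\{\mu(J): J\subseteq\bar{\mathfrak m}\text{ a homogeneous ideal with }J^2=\bar{\mathfrak m}^2\}$. *)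

(* Defs.v *)
From HB Require Import structures.
From mathcomp Require Import all_boot all_order all_algebra.
From mathcomp Require Export generic_quotient ring_quotient.
From mathcomp.multinomials Require Export mpoly.
From Stdlib Require Import ClassicalEpsilon.

Set Implicit Arguments.
Unset Strict Implicit.
Unset Printing Implicit Defensive.

Import GRing.Theory.
Local Open Scope ring_scope.
Local Open Scope quotient_scope.

Section Ideals.
Variable A : comNzRingType.
Implicit Types J K : A -> Prop.

Definition subideal J K := forall x, J x -> K x.

Definition eqideal J K := forall x, J x <-> K x.

Definition is_ideal J :=
  [/\ J 0, (forall x y, J x -> J y -> J (x + y)) & forall a x, J x -> J (a * x)].

Definition ideal_gen (T : finType) (f : T -> A) (B : {set T}) (x : A) :=
  exists c : T -> A, x = \sum_(i in B) c i * f i.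

Definition ideal_mul J K (x : A) :=
  exists m (a b : 'I_m -> A),
    (forall i, J (a i) /\ K (b i)) /\ x = \sum_(i < m) a i * b i.

(* The family f generates J and no proper subfamily does. *)
Definition minimally_generates (t : nat) (f : 'I_t -> A) J :=
  eqideal J (ideal_gen f [set: 'I_t]) /\
  forall B : {set 'I_t}, eqideal J (ideal_gen f B) -> B = [set: 'I_t].

End Ideals.

Section Reductions.
Variables (k : fieldType) (n : nat) (I : idealr {mpoly k[n]}).
Local Notation R := {ideal_quot I}.
Implicit Types J N : R -> Prop.

Definition kscale (c : k) (x : R) : R := \pi_R (c%:MP) * x.

Definition homog_elt (d : nat) (x : R) :=
  exists2 p : {mpoly k[n]}, p \is d.-homog & x = \pi_R p.

(* J is the sum of its graded pieces: each x in J is a sum of elements of J,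
   the i-th of them homogeneous of degree i. *)
Definition homog_ideal J :=
  is_ideal J /\
  forall x, J x ->
    exists m (y : 'I_m -> R),
      (forall i : 'I_m, homog_elt i (y i) /\ J (y i)) /\ x = \sum_(i < m) y i.

Definition mbar : R -> Prop :=
  ideal_gen (fun i : 'I_n => \pi_R 'X_i) [set: 'I_n].

(* J / N has dimension d over k: b induces a k-basis of it. *)
Definition quot_dim J N (d : nat) :=
  exists b : 'I_d -> R,
    [/\ forall i, J (b i),
        forall x, J x ->
          exists c : 'I_d -> k, N (x - \sum_(i < d) kscale (c i) (b i))
      & forall c : 'I_d -> k,
          N (\sum_(i < d) kscale (c i) (b i)) -> forall i, c i = 0].

(* Unspecified if J / mbar J is infinite-dimensional over k, which never
   happens for an ideal J, as R is Noetherian. *)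
Definition mu J : nat :=
  epsilon (inhabits 0%N) (quot_dim J (ideal_mul mbar J)).

Definition cs_ideal J :=
  [/\ homog_ideal J, subideal J mbar
    & eqideal (ideal_mul J J) (ideal_mul mbar mbar)].

Definition is_cs (c : nat) :=
  (exists2 J, cs_ideal J & mu J = c) /\
  (forall J, cs_ideal J -> (c <= mu J)%N).

Definition cs : nat := epsilon (inhabits 0%N) is_cs.

End Reductions.

Arguments mbar {k n} I.
Arguments cs {k n} I.

(* Main.v *)
(* If J^2 = m^2, where m is the maximal ideal, then m^2 = J^2 <= mJ <= m^2, so
   J/mJ = J/m^2 embeds in m/m^2 and mu(J) <= n.  If b_1, ..., b_d is a basis of
   J/m^2, then m^2 = J^2 is spanned modulo m^3 by the products b_i b_j, i <= j.
   Lifted to the polynomial ring, this says that these binomial(d + 1, 2)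
   products and the t generators of I span the binomial(n + 1, 2)-dimensional
   space of quadratic forms, modulo polynomials of order at least 3. *)
From HB Require Import structures.
Require Import Defs.
From mathcomp Require Import all_boot all_order all_algebra.
From mathcomp Require Import ring zify.
From Stdlib Require Import Classical ClassicalEpsilon.

Set Implicit Arguments.
Unset Strict Implicit.
Unset Printing Implicit Defensive.

(** * Sums, products and generators of ideals *)

Section IdealTheory.
Import GRing.Theory.
Local Open Scope ring_scope.
Variable A : comNzRingType.
Implicit Types J K : A -> Prop.

Lemma is_ideal_sum J (T : finType) (F : T -> A) :
  is_ideal J -> (forall i, J (F i)) -> J (\sum_i F i).
Proof. by move=> [J0 JD _] JF; apply: (big_ind J). Qed.

Lemma ideal_mulM J K x y : J x -> K y -> ideal_mul J K (x * y).
Proof.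
by move=> Jx Ky; exists 1%N, (fun=> x), (fun=> y); split=> //; rewrite big_ord1.
Qed.

Lemma ideal_mul_is_ideal J K : is_ideal J -> is_ideal (ideal_mul J K).
Proof.
move=> [_ _ JM]; split.
- by exists 0%N, (fun=> 0), (fun=> 0); split=> [[]|] //; rewrite big_ord0.
- move=> _ _ [m1 [a1 [b1 [h1 ->]]]] [m2 [a2 [b2 [h2 ->]]]].
  exists (m1 + m2)%N,
    (fun i => match split i with inl j => a1 j | inr j => a2 j end),
    (fun i => match split i with inl j => b1 j | inr j => b2 j end).
  split=> [i|]; first by case: split.
  rewrite big_split_ord; congr (_ + _); apply: eq_bigr => i _.
    by rewrite -[lshift _ _]/(unsplit (inl i)) unsplitK.
  by rewrite -[rshift _ _]/(unsplit (inr i)) unsplitK.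
move=> c _ [m [a [b [h ->]]]]; exists m, (fun i => c * a i), b; split=> [i|].
  by have [Ja Kb] := h i; split=> //; apply: JM.
by rewrite mulr_sumr; apply: eq_bigr => i _; rewrite mulrA.
Qed.

Lemma ideal_mulS J J' K K' : subideal J J' -> subideal K K' ->
  subideal (ideal_mul J K) (ideal_mul J' K').
Proof.
move=> sJ sK _ [m [a [b [h ->]]]]; exists m, a, b; split=> // i.
by have [/sJ ? /sK ?] := h i.
Qed.

Lemma ideal_genTP (T : finType) (f : T -> A) x :
  ideal_gen f [set: T] x <-> exists c : T -> A, x = \sum_i c i * f i.
Proof.
by split=> -[c xE]; exists c; rewrite xE; [|apply/esym];
  apply: eq_bigl => i; rewrite inE.
Qed.

Lemma ideal_gen_is_ideal (T : finType) (f : T -> A) (B : {set T}) :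
  is_ideal (ideal_gen f B).
Proof.
split=> [|_ _ [c ->] [e ->]|a _ [c ->]].
- by exists (fun=> 0); rewrite big1 // => i _; rewrite mul0r.
- by exists (fun i => c i + e i); rewrite -big_split; apply: eq_bigr => i _;
    rewrite mulrDl.
by exists (fun i => a * c i); rewrite mulr_sumr; apply: eq_bigr => i _;
  rewrite mulrA.
Qed.

Lemma ideal_gen_mem (T : finType) (f : T -> A) (B : {set T}) i :
  i \in B -> ideal_gen f B (f i).
Proof.
move=> iB; exists (fun j => (j == i)%:R); rewrite (bigD1 i) //= eqxx mul1r.
by rewrite big1 ?addr0 // => j /andP[_ /negPf->]; rewrite mul0r.
Qed.

End IdealTheory.

(** * Polynomials by order of vanishing at the origin *)

Section OrderOfVanishing.
Import GRing.Theory.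
Local Open Scope ring_scope.
Variables (k : fieldType) (n : nat).
Implicit Types p q : {mpoly k[n]}.

(* p lies in the d-th power of the maximal ideal (x_1, ..., x_n). *)
Definition order_ge d p := forall m : 'X_{1..n}, (mdeg m < d)%N -> p@_m = 0.

Lemma order_geD d p q : order_ge d p -> order_ge d q -> order_ge d (p + q).
Proof. by move=> hp hq m md; rewrite mcoeffD hp // hq // addr0. Qed.

Lemma order_ge_sum d (T : finType) (F : T -> {mpoly k[n]}) :
  (forall i, order_ge d (F i)) -> order_ge d (\sum_i F i).
Proof.
by move=> h; apply: big_ind => //; [move=> m _; rewrite mcoeff0 | exact: order_geD].
Qed.

Lemma order_geM d e p q : order_ge d p -> order_ge e q ->
  order_ge (d + e) (p * q).
Proof.
move=> hp hq m mde; rewrite mcoeffM big1 // => -[/= i j] /eqP mE.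
have {mde} : (mdeg i + mdeg j < d + e)%N by rewrite -mdegD -mE.
have [id _|di ij] := ltnP (mdeg i) d; first by rewrite hp // mul0r.
by rewrite hq ?mulr0 //; lia.
Qed.

Lemma order_geW d e p : (d <= e)%N -> order_ge e p -> order_ge d p.
Proof. by move=> de hp m md; apply/hp/(leq_trans md). Qed.

Lemma order_geMl d p q : order_ge d q -> order_ge d (p * q).
Proof. exact: (@order_geM 0%N). Qed.

(** Serves to replace polynomial coefficients by scalars: the discarded part gains one order. *)
Lemma order_ge_subC p : order_ge 1 (p - (p@_0)%:MP).
Proof.
move=> m; rewrite ltnS leqn0 mdeg_eq0 => /eqP->.
by rewrite mcoeffB mcoeffC eqxx mulr1 subrr.
Qed.

Lemma order_geX i : order_ge 1 ('X_i : {mpoly k[n]}).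
Proof.
move=> m; rewrite ltnS leqn0 mdeg_eq0 => /eqP->.
by rewrite mcoeffX -mdeg_eq0 mdeg1.
Qed.

Lemma dhomog_order_ge d p : p \is d.-homog -> order_ge d p.
Proof.
by move=> hp m md; apply: (dhomog_nemf_coeff hp); rewrite neq_ltn md.
Qed.

(** From left to right, every monomial of [p] has a positive exponent at some [i], so ['X_i] divides
    it. *)
Lemma order_ge1P p :
  order_ge 1 p <-> ideal_gen (fun i : 'I_n => 'X_i) [set: 'I_n] p.
Proof.
split=> [p1|/ideal_genTP[c ->]]; last first.
  by apply: order_ge_sum => i; apply: order_geMl (order_geX i).
have idG : is_ideal (ideal_gen (fun i : 'I_n => 'X_i : {mpoly k[n]}) setT).
  exact: ideal_gen_is_ideal.
have [G0 GD GM] := idG; rewrite [p]mpolyE big_seq; apply: big_ind => // m.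
rewrite mcoeff_msupp => pm; rewrite -mul_mpolyC; apply: (GM).
have /existsP[i mi] : [exists i, m i != 0%N].
  apply: contraR pm => /existsPn m0; rewrite p1 // ltnS leqn0 mdegE sum_nat_eq0.
  by apply/forallP => i; rewrite -[_ == _]negbK m0.
have Um : (U_(i) <= m)%MM.
  by apply/mnm_lepP => j; rewrite mnm1E; case: eqVneq => [<-|//]; rewrite lt0n.
by rewrite -(submK Um) mpolyXD; apply: (GM); apply: ideal_gen_mem; rewrite inE.
Qed.

End OrderOfVanishing.

(** * Counting quadratic forms *)

Section QuadraticCount.
Import GRing.Theory.
Local Open Scope ring_scope.

(** Each second entry [j] allows [j + 1] first entries, and these numbers add up to the binomial. *)
Lemma card_le_pairs n : #|{: {ij : 'I_n * 'I_n | (ij.1 <= ij.2)%N}}| = 'C(n.+1, 2).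
Proof.
rewrite card_sig -bin2_sum big_nat_recl // add0n big_mkord -sum1_card.
rewrite (eq_bigl (fun ij : 'I_n * 'I_n => predT ij.1 && (ij.1 <= ij.2)%N)) //.
rewrite -(pair_big_dep predT (fun i j : 'I_n => (i <= j)%N) (fun _ _ => 1%N)) /=.
rewrite (exchange_big_dep predT) //=; apply: eq_bigr => j _.
by rewrite -(big_ord_widen n (fun=> 1%N) (ltn_ord j)) sum1_card card_ord.
Qed.

Variables (k : fieldType) (n : nat).
Implicit Types p q : {mpoly k[n]}.

(** Taking degree-two coefficients is a linear map that kills order 3 and sends the monomials
    ['X_a * 'X_b] to the unit vectors of a space of dimension ['C(n.+1, 2)]. By hypothesis the
    images of the [p i * p j], [i <= j], and of the [f l] span that space. *)
Lemma quadrics_span d t (p : 'I_d -> {mpoly k[n]}) (f : 'I_t -> {mpoly k[n]}) :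
  (forall a b : 'I_n, exists c : 'I_d -> 'I_d -> k, exists e : 'I_t -> k,
     order_ge 3 ('X_a * 'X_b - (\sum_i \sum_j c i j *: (p i * p j)
                                + \sum_l e l *: f l))) ->
  ('C(n.+1, 2) <= 'C(d.+1, 2) + t)%N.
Proof.
move=> span.
pose P m := {ij : 'I_m * 'I_m | (ij.1 <= ij.2)%N}.
pose mon (u : P n) := (U_((sval u).1) + U_((sval u).2))%MM.
have mon_inj : injective mon.
  move=> [[i j] /= ij] [[i' j'] /= ij'] /mnmP E; apply: val_inj => /=.
  suff [/val_inj-> /val_inj->] : (i = i' :> nat) /\ (j = j' :> nat) by [].
  (* Since both pairs are sorted, comparing the exponents at these four indices determines them. *)
  move: (E i) (E j) (E i') (E j'); rewrite !mnmDE !mnm1E -!val_eqE /=; lia.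
pose phi q : 'rV[k]_#|{: P n}| := \row_u q@_(mon (enum_val u)).
have phi_lin : linear phi.
  by move=> c x y; apply/rowP => u; rewrite !mxE mcoeffD mcoeffZ.
pose phiL := GRing.isLinear.Build _ _ _ _ phi phi_lin.
pose phi' : {linear _ -> _} := HB.pack phi phiL.
have phi3 q : order_ge 3 q -> phi' q = 0.
  by move=> q3; apply/rowP => u; rewrite !mxE q3 // mdegD !mdeg1.
pose B1 := \matrix_(u < #|{: P d}|)
  phi' (p (sval (enum_val u)).1 * p (sval (enum_val u)).2).
pose B2 := \matrix_(l < t) phi' (f l).
have B1p i j : (phi' (p i * p j)%R <= B1)%MS.
  (* By commutativity sorted pairs suffice, which keeps [B1] down to ['C(d.+1, 2)] rows. *)
  wlog ij : i j / (i <= j)%N => [h|].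
    by have [/h//|/ltnW/h] := leqP i j; rewrite mulrC.
  pose u : P d := exist _ (i, j) ij.
  have -> : phi' (p i * p j)%R = row (enum_rank u) B1 by rewrite rowK enum_rankK.
  exact: row_sub.
have full : (1%:M <= B1 + B2)%MS.
  apply/row_subP => u; set ab := sval (enum_val u).
  have -> : row u 1%:M = phi' ('X_ab.1 * 'X_ab.2).
    apply/rowP => v; rewrite !mxE -mpolyXD mcoeffX.
    by rewrite (inj_eq mon_inj) (inj_eq enum_val_inj).
  have [c [e /phi3]] := span ab.1 ab.2; rewrite linearB => /eqP; rewrite subr_eq0 => /eqP->.
  rewrite linearD !linear_sum addmx_sub_adds ?summx_sub // => [i _|l _].
    by rewrite linear_sum summx_sub // => j _; rewrite linearZ scalemx_sub.
  by rewrite linearZ scalemx_sub // -(rowK (fun l => phi' (f l))) row_sub.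
rewrite -!card_le_pairs -(mxrank1 k #|{: P n}|).
apply: leq_trans (mxrankS full) (leq_trans (mxrank_adds_leqif _ _) _).
by rewrite leq_add // rank_leq_row.
Qed.

End QuadraticCount.

(** * The quotient ring as an algebra over [k] *)

Section QuotientAlgebra.
Import GRing.Theory.
Local Open Scope ring_scope.
Local Open Scope quotient_scope.
Variables (k : fieldType) (n : nat) (I : idealr {mpoly k[n]}).
Local Notation R := {ideal_quot I}.
Implicit Types J N : R -> Prop.

Let pi : {rmorphism {mpoly k[n]} -> R} := \pi_R.

Lemma pi_eq p q : pi p = pi q -> p - q \in I.
Proof. by move=> h; rewrite Quotient.idealrBE; apply/eqP. Qed.

Lemma kscaleA (c e : k) (x : R) : kscale c (kscale e x) = kscale (c * e) x.
Proof. by rewrite /kscale mpolyCM (rmorphM pi) mulrA. Qed.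

Lemma kscale0 (x : R) : kscale 0 x = 0.
Proof. by rewrite /kscale mpolyC0 (rmorph0 pi) mul0r. Qed.

Lemma kscale1 (x : R) : kscale 1 x = x.
Proof. by rewrite /kscale mpolyC1 (rmorph1 pi) mul1r. Qed.

Lemma kscaleNl (c : k) (x : R) : kscale (- c) x = - kscale c x.
Proof. by rewrite /kscale mpolyCN (rmorphN pi) mulNr. Qed.

Lemma kscaleBr (c : k) (x y : R) : kscale c (x - y) = kscale c x - kscale c y.
Proof. exact: mulrBr. Qed.

Lemma kscaleDr (c : k) (x y : R) : kscale c (x + y) = kscale c x + kscale c y.
Proof. exact: mulrDr. Qed.

Lemma is_ideal_kscale N c x : is_ideal N -> N x -> N (kscale c x).
Proof. by case=> _ _; apply. Qed.

Lemma kscale_sumr (T : finType) (c : k) (F : T -> R) :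
  kscale c (\sum_i F i) = \sum_i kscale c (F i).
Proof. exact: mulr_sumr. Qed.

Lemma kscale_suml (T : finType) (F : T -> k) (x : R) :
  kscale (\sum_i F i) x = \sum_i kscale (F i) x.
Proof. by rewrite /kscale (raddf_sum (@mpolyC n k)) (rmorph_sum pi) mulr_suml. Qed.

Lemma kscale_pi c p : kscale c (pi p) = pi (c *: p).
Proof. by rewrite -mul_mpolyC rmorphM. Qed.

(** * Independence and dimension modulo an ideal *)

Definition free_mod N d (b : 'I_d -> R) :=
  forall c : 'I_d -> k, N (\sum_(i < d) kscale (c i) (b i)) -> forall i, c i = 0.

(** A nonzero [v] in the left kernel of the coefficient matrix cancels every [e j]. The combination
    of the [b i] with coefficients [v] is then one of the differences [b i - \sum_j c i j e j], so
    it lies in [N], against freeness. *)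
Lemma free_mod_le N m d (e : 'I_m -> R) (b : 'I_d -> R) : is_ideal N ->
  (forall i, exists c : 'I_m -> k, N (b i - \sum_(j < m) kscale (c j) (e j))) ->
  free_mod N b -> (d <= m)%N.
Proof.
move=> idN /fin_all_exists[c bE] free_b.
pose M := \matrix_(i < d, j < m) c i j.
suff /eqP <- : row_free M by exact: rank_leq_col.
apply/negPn/negP; rewrite -kermx_eq0 => /rowV0Pn[v /sub_kermxP vM].
case/negP; apply/eqP/rowP => i; rewrite mxE; move: i; apply: free_b.
have -> : \sum_i kscale (v 0 i) (b i) =
    \sum_i kscale (v 0 i) (b i - \sum_j kscale (c i j) (e j)).
  apply/eqP; rewrite -subr_eq0 -sumrB; apply/eqP.
  transitivity (\sum_i \sum_j kscale (v 0 i * c i j) (e j)).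
    apply: eq_bigr => i _; rewrite -kscaleBr opprB addrC subrK kscale_sumr.
    by apply: eq_bigr => j _; rewrite kscaleA.
  rewrite exchange_big big1 // => j _; rewrite -kscale_suml.
  have -> : \sum_i v 0 i * c i j = (v *m M) 0 j.
    by rewrite mxE; apply: eq_bigr => i _; rewrite mxE.
  by rewrite vM mxE kscale0.
by apply: is_ideal_sum => // i; apply: is_ideal_kscale.
Qed.

(** A free family in [J] that does not span can be enlarged by one element, and the bound [n0] stops
    this process. *)
Lemma quot_dim_exists J N n0 : is_ideal N ->
  (forall d (b : 'I_d -> R), (forall i, J (b i)) -> free_mod N b -> (d <= n0)%N) ->
  exists d, quot_dim J N d.
Proof.
move=> idN bound.
(* The induction runs on the fuel [g]: at [g = 0] the free family would have more than [n0]
   members. *)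
suff ext g d (b : 'I_d -> R) : (n0 < d + g)%N -> (forall i, J (b i)) ->
    free_mod N b -> exists d, quot_dim J N d.
  by apply: (ext n0.+1 0%N (fun=> 0)) => [//|[]//|c _ []].
elim: g d b => [|g IHg] d b dg Jb free_b.
  by move: (bound d b Jb free_b) dg; rewrite addn0 ltnNge => ->.
have [spans|] := classic (forall x, J x ->
   exists c : 'I_d -> k, N (x - \sum_(i < d) kscale (c i) (b i))).
  by exists d, b.
move=> /not_all_ex_not[x xP]; have [Jx xNspan] := imply_to_and _ _ xP.
apply: (IHg d.+1 (fun i => oapp b x (unlift ord0 i))) => [|i|c].
- by rewrite addSnnS.
- by case: (unlift ord0 i).
rewrite big_ord_recl unlift_none; under eq_bigr do rewrite liftK.
(* If the coefficient of [x] vanishes, freeness of [b] applies; otherwise dividing by it puts [x] in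
   the span of [b] modulo [N]. *)
move=> /= Nc; have [c0|c0] := eqVneq (c ord0) 0.
  rewrite c0 kscale0 add0r in Nc => i.
  by case: (unliftP ord0 i) => [j ->|-> //]; apply: (free_b (c \o lift ord0)).
case: xNspan; exists (fun i => - ((c ord0)^-1 * c (lift ord0 i))).
move/(is_ideal_kscale (c ord0)^-1 idN): Nc.
rewrite kscaleDr kscale_sumr kscaleA mulVf // kscale1.
congr (N (_ + _)); rewrite -sumrN; apply: eq_bigr => i _.
by rewrite kscaleA kscaleNl opprK.
Qed.

(** * The ideal [mbar] and its square *)

Lemma mbar_is_ideal : is_ideal (mbar I).
Proof. exact: ideal_gen_is_ideal. Qed.

Lemma mbarP x : mbar I x <-> exists2 p, order_ge 1 p & x = pi p.
Proof.
split=> [/ideal_genTP[c ->]|[p /order_ge1P/ideal_genTP[c ->] ->]]; last first.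
  apply/ideal_genTP; exists (fun i => pi (c i)); rewrite rmorph_sum.
  by apply: eq_bigr => i _; rewrite rmorphM.
exists (\sum_i repr (c i) * 'X_i).
  by apply/order_ge1P/ideal_genTP; exists (fun i => repr (c i)).
rewrite rmorph_sum; apply: eq_bigr => i _.
by rewrite rmorphM /= reprK.
Qed.

Lemma mbar2_lift x : ideal_mul (mbar I) (mbar I) x ->
  exists2 p, order_ge 2 p & x = pi p.
Proof.
move=> [m [a [b [mab ->]]]].
have /fin_all_exists2[p p1 aE] : forall i, exists2 p, order_ge 1 p & a i = pi p.
  by move=> i; apply/mbarP; case: (mab i).
have /fin_all_exists2[q q1 bE] : forall i, exists2 p, order_ge 1 p & b i = pi p.
  by move=> i; apply/mbarP; case: (mab i).
exists (\sum_i p i * q i); first by apply: order_ge_sum => i; exact: (@order_geM _ _ 1 1).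
by rewrite rmorph_sum; apply: eq_bigr => i _; rewrite aE bE rmorphM.
Qed.

(** Cutting lifts of the coefficients down to their constant terms changes each summand by an
    element of [mbar] times a variable. *)
Lemma mbar_span_mod x : mbar I x -> exists c : 'I_n -> k,
  ideal_mul (mbar I) (mbar I) (x - \sum_(i < n) kscale (c i) (pi 'X_i)).
Proof.
move=> /ideal_genTP[c ->]; exists (fun i => (repr (c i))@_0%MM).
rewrite -sumrB; apply: is_ideal_sum.
  exact: ideal_mul_is_ideal mbar_is_ideal.
move=> i; rewrite -mulrBl -[c i in X in X - _]reprK -(rmorphB pi).
apply: ideal_mulM; last by apply: ideal_gen_mem; rewrite inE.
apply/mbarP; exists (repr (c i) - ((repr (c i))@_0%MM)%:MP) => //.
exact: order_ge_subC.
Qed.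

Lemma mbar_homog : homog_ideal (mbar I).
Proof.
split; first exact: mbar_is_ideal.
move=> _ /mbarP[p p1 ->].
(* For nonzero [p], [msize p] is one more than the degree, so the indices below it reach every
   degree in [p]. *)
exists (msize p), (fun i => pi (pihomog mdeg i p)); split=> [i|]; last first.
  by rewrite -rmorph_sum -pihomog_partitionE.
split; first by exists (pihomog mdeg i p); first exact: pihomogP.
apply/mbarP; exists (pihomog mdeg i p) => // m; rewrite ltnS leqn0 => m0.
rewrite pihomogE raddf_sum big1 //= => m' _; rewrite mcoeffZ mcoeffX.
by case: eqVneq => [->|_]; rewrite ?mulr0 // p1 ?mul0r // (eqP m0).
Qed.

Lemma cs_ideal_mbar : cs_ideal (mbar I).
Proof. by split; first exact: mbar_homog. Qed.

(** * Ideals [J] with the same square as [mbar] *)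

Section CsIdeal.
Variables (J : R -> Prop) (csJ : cs_ideal J).

(* mbar^2 = J^2 <= mbar J <= mbar^2 *)
Lemma cs_ideal_mbarM :
  eqideal (ideal_mul (mbar I) J) (ideal_mul (mbar I) (mbar I)).
Proof.
have [_ sJ sqJ] := csJ.
by split=> [|/sqJ]; apply: ideal_mulS.
Qed.

Lemma cs_ideal_mbarM_is_ideal : is_ideal (ideal_mul (mbar I) J).
Proof. exact: ideal_mul_is_ideal mbar_is_ideal. Qed.

(** [J] lies in [mbar], which the [n] variables span modulo [mbar^2 = mbar J]. *)
Lemma cs_ideal_free_le d (b : 'I_d -> R) :
  (forall i, J (b i)) -> free_mod (ideal_mul (mbar I) J) b -> (d <= n)%N.
Proof.
move=> Jb; apply: (free_mod_le (e := fun i => pi 'X_i)) => [|i].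
  exact: cs_ideal_mbarM_is_ideal.
have [_ /(_ _ (Jb i))/mbar_span_mod[c cP] _] := csJ.
by exists c; apply/cs_ideal_mbarM.
Qed.

(** The bound on free families makes the dimension exist, so the [epsilon] in [mu] returns a true
    dimension. *)
Lemma cs_ideal_muP : quot_dim J (ideal_mul (mbar I) J) (mu J).
Proof.
apply: epsilon_spec; apply: (quot_dim_exists (n0 := n)).
  exact: cs_ideal_mbarM_is_ideal.
exact: cs_ideal_free_le.
Qed.

Lemma cs_ideal_mu_le : (mu J <= n)%N.
Proof. by have [b [Jb _ /(cs_ideal_free_le Jb)]] := cs_ideal_muP. Qed.

Lemma bin_le_mu t (f : 'I_t -> {mpoly k[n]}) :
  (forall i, order_ge 2 (f i)) ->
  (forall p, p \in I -> ideal_gen f [set: 'I_t] p) ->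
  ('C(n.+1, 2) <= 'C((mu J).+1, 2) + t)%N.
Proof.
move=> f2 If; have [_ sJ sqJ] := csJ.
have [b [Jb spanb _]] := cs_ideal_muP.
have /fin_all_exists2[p p1 bE] : forall i, exists2 p, order_ge 1 p & b i = pi p.
  by move=> i; apply/mbarP/sJ.
apply: (quadrics_span (p := p) (f := f)) => a a'.
(* As [mbar J = mbar^2], the remainder modulo the span of [b] lifts to order 2. *)
have J_lift u : J u -> exists c : 'I_(mu J) -> k, exists2 q, order_ge 2 q &
    u = pi (\sum_i c i *: p i + q).
  move=> /spanb[c /cs_ideal_mbarM/mbar2_lift[q q2 qE]]; exists c, q => //.
  rewrite rmorphD -qE rmorph_sum addrC -[LHS](subrK (\sum_i kscale (c i) (b i))).
  by congr (_ + _); apply: eq_bigr => i _; rewrite bE kscale_pi.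
(* [good] contains the products of elements of [J] and is closed under sums, hence holds on
   [J^2 = mbar^2]. *)
pose good (x : R) := exists c : 'I_(mu J) -> 'I_(mu J) -> k, exists2 q,
  order_ge 3 q & x = pi (\sum_i \sum_j c i j *: (p i * p j) + q).
have goodM u v : J u -> J v -> good (u * v).
  move=> /J_lift[c [q q2 ->]] /J_lift[e [r r2 ->]].
  exists (fun i j => c i * e j).
  (* The two mixed products have order 3 and [q * r] has order 4. *)
  exists ((\sum_i c i *: p i) * r + q * (\sum_i e i *: p i) + q * r).
    have lin1 (c' : 'I_(mu J) -> k) : order_ge 1 (\sum_i c' i *: p i).
      by apply: order_ge_sum => i; rewrite -mul_mpolyC; apply: order_geMl.
    apply: order_geD; first apply: order_geD.
    - exact: (@order_geM _ _ 1 2).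
    - exact: (@order_geM _ _ 2 1).
    - by apply: order_geW (order_geM q2 r2).
  rewrite -rmorphM; congr (pi _).
  have -> : \sum_i \sum_j (c i * e j) *: (p i * p j) =
      (\sum_i c i *: p i) * (\sum_j e j *: p j).
    rewrite big_distrlr /=; apply: eq_bigr => i _; apply: eq_bigr => j _.
    by rewrite -scalerAl -scalerAr scalerA.
  by ring.
have goodD x y : good x -> good y -> good (x + y).
  move=> [c [q q3 ->]] [e [r r3 ->]].
  exists (fun i j => c i j + e i j), (q + r); first exact: order_geD.
  rewrite -rmorphD addrACA -big_split; congr (pi (_ + _)).
  apply: eq_bigr => i _; rewrite -big_split; apply: eq_bigr => j _.
  by rewrite scalerDl.
have good0 : good 0.
  exists (fun _ _ => 0), 0; first by move=> m _; rewrite mcoeff0.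
  rewrite addr0 big1 ?rmorph0 // => i _; rewrite big1 // => j _.
  by rewrite scale0r.
have [c [q q3 /pi_eq/If/ideal_genTP[g gE]]] : good (pi ('X_a * 'X_a')).
  have /sqJ[m [u [v [uvJ ->]]]] : ideal_mul (mbar I) (mbar I) (pi ('X_a * 'X_a')).
    by rewrite rmorphM; apply: ideal_mulM; apply: ideal_gen_mem; rewrite inE.
  by apply: (big_ind good) => // i _; have [] := uvJ i; apply: goodM.
(* Only the constant term of [g l] matters: the rest has order 1 and [f l] has order 2. *)
exists c, (fun l => (g l)@_0%MM).
have -> : 'X_a * 'X_a' - (\sum_i \sum_j c i j *: (p i * p j) +
    \sum_l (g l)@_0%MM *: f l) = q + \sum_l (g l - ((g l)@_0%MM)%:MP) * f l.
  under [X in _ = q + X]eq_bigr do rewrite mulrBl mul_mpolyC.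
  rewrite sumrB -gE; ring.
apply: order_geD => //; apply: order_ge_sum => l.
exact: order_geM (order_ge_subC _) (f2 l).
Qed.

End CsIdeal.

(** [mbar] itself is an admissible ideal, so descent on the values of [mu] reaches a minimum. *)
Lemma is_cs_cs : is_cs I (cs I).
Proof.
apply: epsilon_spec.
suff ex_min d J : cs_ideal J -> mu J = d -> exists c, is_cs I c.
  exact: (ex_min _ _ cs_ideal_mbar erefl).
elim/ltn_ind: d J => d IHd J csJ muJ.
have [min_d|] := classic
  (forall J, cs_ideal J -> (d <= mu J)%N).
  by exists d; split=> //; exists J.
move=> /not_all_ex_not[J' J'P]; have [csJ' /negP] := imply_to_and _ _ J'P.
by rewrite -ltnNge => /IHd/(_ _ csJ' erefl).
Qed.

End QuotientAlgebra.

(** * Numerical consequences of the count *)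

Theorem proposition5p1 (k : fieldType) (n t : nat)
    (I : idealr {mpoly k[n]}) (f : 'I_t -> {mpoly k[n]}) :
  0 < t ->
  (forall i, f i \is 2.-homog) ->
  minimally_generates f (fun p => p \in I) ->
  [/\ 'C(n.+1, 2) - t <= 'C((cs I).+1, 2),
      forall s : nat, s <= n - 1 ->
        2 * t <= (s + 1) * (2 * n - s) -> n - s - 1 <= cs I
    & t <= n - 1 -> cs I = n /\ mu (mbar I) = n].
Proof.
move=> t0 f2 [If _].
have count (J : {ideal_quot I} -> Prop) :
    cs_ideal J -> 'C(n.+1, 2) <= 'C((mu J).+1, 2) + t.
  move=> csJ; apply: (bin_le_mu csJ (f := f)) => [i|p /If //].
  exact: dhomog_order_ge.
have [[J csJ muJ] cs_min] := is_cs_cs I.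
have csn : mu (mbar I) <= n := cs_ideal_mu_le (cs_ideal_mbar I).
have cs_mbar : cs I <= mu (mbar I) := cs_min _ (cs_ideal_mbar I).
have countI : 'C(n.+1, 2) <= 'C((cs I).+1, 2) + t by rewrite -muJ; exact: count.
have bin2E m : 2 * 'C(m.+1, 2) = m.+1 * m by rewrite -mul_bin_diag bin1.
have {}bin2I : n.+1 * n <= (cs I).+1 * cs I + 2 * t by rewrite -!bin2E; lia.
split=> [|s sn ts|tn]; first by rewrite leq_subLR addnC.
  (* Truncated subtraction admits [n = s = 0], where the bound is 0. *)
  have [n0|n0] := posnP n; first by lia.
  have [r nE] : exists r, n = s + 1 + r by exists (n - s - 1); lia.
  rewrite leqNgt; apply/negP => csr.
  have {}csr : cs I < r by lia.
  (* With [n = s + 1 + r] one has [n(n + 1) - (s + 1)(2n - s) = r(r + 1)]. Hence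
     [r(r + 1) <= (cs + 1)cs <= r(r - 1)], impossible as [r > 0]. *)
  have rr : (cs I).+1 * cs I <= r * r.-1 by apply: leq_mul; lia.
  move: (cs I) rr bin2I ts => c; rewrite nE; nia.
(* This closes the chain [cs I <= mu (mbar I) <= n]. *)
suff : n <= cs I by lia.
rewrite leqNgt; apply/negP => csr.
have rr : (cs I).+1 * cs I <= n * n.-1 by apply: leq_mul; lia.
(* The count would give [n(n + 1) <= n(n - 1) + 2(n - 1)], that is [2n <= 2n - 2]. *)
nia.
Qed.
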